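(* Let $\Theta=\{u,d\}\times\{l,r\}$ with uniform prior $\pi$, and consider the three decision problems with action sets $A_1=\{a_U,a_D\}$, $A_2=\{a_L,a_R\}$, $A_3=\{a_{\mathrm{diag}},a_{\mathrm{off}}\}$ and the nested Shannon cost with nest set $N=\{U,D,L,R\}$ and weights $\zeta,\eta>0$ described in the context. Fix $\eta>0$. For each $j\in\{1,2,3\}$ (and each $\zeta>0$) let $P^j\in\Delta(A_j)^\Theta$ be an optimal stochastic choice rule. As $\zeta\to0$, for all $a_1\in A_1$, $a_2\in A_2$ and $\theta\in\Theta$, $$P^1_\theta(a_1)\to a_1(\theta)\qquad\text{and}\qquad P^2_\theta(a_2)\to a_2(\theta).$$ Moreover, for every $\zeta>0$, $\theta\in\Theta$ and $a_3\in A_3$, $$P^3_\theta(a_3)=\begin{cases}\dfrac{e^{1/\eta}}{e^{1/\eta}+1}&\text{if }a_3(\theta)=1,\\[6pt]\dfrac{1}{e^{1/\eta}+1}&\text{otherwise.}\end{cases}$$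
   Context: Events: $U=\{u\}\times\{l,r\}$, $D=\{d\}\times\{l,r\}$, $L=\{u,d\}\times\{l\}$, $R=\{u,d\}\times\{r\}$. For $i\in\{U,D,L,R\}$, $a_i(\theta)=1$ if $\theta\in i$ and $0$ otherwise. $a_{\mathrm{diag}}(\theta)=1$ if $\theta\in\{(u,l),(d,r)\}$ and $0$ otherwise; $a_{\mathrm{off}}(\theta)=1$ if $\theta\in\{(u,r),(d,l)\}$ and $0$ otherwise. Nest structure: $\nu\in\Delta(N\times\Theta)$ has marginal $\bar\nu(i)=1/4$ for all $i\in N$ and conditionals $\nu_i(\theta)=1/2$ for each of the two states $\theta$ in event $i$ (and $0$ otherwise); its marginal on $\Theta$ is $\pi$. The nested Shannon entropy with weights $\zeta,\eta$ is $$H_\pi(p)=\min\Big\{\zeta D_{\mathrm{KL}}(\bar\mu\Vert\bar\nu)+\eta\sum_{i\in N}\bar\mu(i)D_{\mathrm{KL}}(\mu_i\Vert\nu_i):\ \mu\in\Delta(N\times\Theta)\text{ with marginal }p\text{ on }\Theta\Big\},$$ where $\bar\mu$ is the marginal of $\mu$ on $N$, $\mu_i$ the conditional on $\Theta$ given $i$ (terms with $\bar\mu(i)=0$ contribute $0$), and $D_{\mathrm{KL}}$ is Kullback–Leibler divergence ($+\infty$ without absolute continuity). The associated posterior-separable cost is $C(P,\pi)=\sum_{a\in\operatorname{supp}P_\pi}P_\pi(a)H_\pi(p_a)$, with $P_\pi=\sum_\theta\pi(\theta)P_\theta$ and $p_a(\theta)=\pi(\theta)P_\theta(a)/P_\pi(a)$.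 $P\in\Delta(A_j)^\Theta$ is optimal in problem $j$ if it maximizes $\sum_\theta\pi(\theta)\sum_{a\in A_j}P_\theta(a)a(\theta)-C(P,\pi)$ over $\Delta(A_j)^\Theta$. *)

(* Defs.v *)
From HB Require Import structures.
From mathcomp Require Import all_boot all_order all_algebra.
From mathcomp Require Import finmap ring lra.
From mathcomp Require Import all_classical all_reals all_analysis.

Set Implicit Arguments.
Unset Strict Implicit.
Unset Printing Implicit Defensive.

Import Order.TTheory GRing.Theory Num.Theory.
Import numFieldNormedType.Exports.

Local Open Scope ring_scope.
Local Open Scope classical_set_scope.

Definition is_dist (R : realType) (T : finType) (p : T -> R) : Prop :=
  (forall x, 0 <= p x) /\ \sum_x p x = 1.

(* +oo without absolute continuity; the convention 0 ln (0 / q) = 0 holds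
   because multiplication by 0 gives 0 and [ln], [/] are total. *)
Definition KL (R : realType) (T : finType) (p q : T -> R) : \bar R :=
  if [forall x, (q x == 0) ==> (p x == 0)]
  then (\sum_x p x * ln (p x / q x))%:E
  else +oo%E.

Definition marg1 (R : realType) (N Theta : finType) (mu : N * Theta -> R)
  (i : N) : R := \sum_t mu (i, t).

Definition marg2 (R : realType) (N Theta : finType) (mu : N * Theta -> R)
  (t : Theta) : R := \sum_i mu (i, t).

(* Only meaningful, and only used, when [marg1 mu i != 0]. *)
Definition cond (R : realType) (N Theta : finType) (mu : N * Theta -> R)
  (i : N) (t : Theta) : R := mu (i, t) / marg1 mu i.

Definition nested_div (R : realType) (N Theta : finType) (zeta eta : R)
  (nu mu : N * Theta -> R) : \bar R :=
  (zeta%:E * KL (marg1 mu) (marg1 nu) +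
   eta%:E * \sum_(i | marg1 mu i != 0%R)
              (marg1 mu i)%:E * KL (cond mu i) (cond nu i))%E.

(* The minimum over a compact set of a lower semicontinuous function,
   hence taken as an infimum in the extended reals. *)
Definition nested_entropy (R : realType) (N Theta : finType) (zeta eta : R)
  (nu : N * Theta -> R) (p : Theta -> R) : \bar R :=
  ereal_inf [set nested_div zeta eta nu mu | mu in
    [set mu : N * Theta -> R | is_dist mu /\ forall t, marg2 mu t = p t]].

(* Actions are payoff functions on the states; a problem is a finite set of
   actions. *)
Definition action (R : realType) (Theta : finType) := {ffun Theta -> R}.

(* [P t a] is the probability of [a] in state [t]; values of [P t] outside
   the action set [A] are irrelevant and never used. *)
Definition is_rule (R : realType) (Theta : finType)
  (A : {fset action R Theta}) (P : Theta -> action R Theta -> R) : Prop :=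
  forall t, (forall a, a \in A -> 0 <= P t a) /\ \sum_(a <- A) P t a = 1.

Definition action_prob (R : realType) (Theta : finType) (prior : Theta -> R)
  (P : Theta -> action R Theta -> R) (a : action R Theta) : R :=
  \sum_t prior t * P t a.

Definition posterior (R : realType) (Theta : finType) (prior : Theta -> R)
  (P : Theta -> action R Theta -> R) (a : action R Theta) (t : Theta) : R :=
  prior t * P t a / action_prob prior P a.

Definition posterior_separable_cost (R : realType) (Theta : finType)
  (prior : Theta -> R) (H : (Theta -> R) -> \bar R)
  (A : {fset action R Theta}) (P : Theta -> action R Theta -> R) : \bar R :=
  (\sum_(a <- A | action_prob prior P a != 0%R)
     (action_prob prior P a)%:E * H (posterior prior P a))%E.

Definition net_payoff (R : realType) (Theta : finType)
  (prior : Theta -> R) (H : (Theta -> R) -> \bar R)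
  (A : {fset action R Theta}) (P : Theta -> action R Theta -> R) : \bar R :=
  ((\sum_t prior t * \sum_(a <- A) P t a * a t)%:E
   - posterior_separable_cost prior H A P)%E.

Definition optimal_rule (R : realType) (Theta : finType)
  (prior : Theta -> R) (H : (Theta -> R) -> \bar R)
  (A : {fset action R Theta}) (P : Theta -> action R Theta -> R) : Prop :=
  is_rule A P /\
  forall Q, is_rule A Q -> (net_payoff prior H A Q <= net_payoff prior H A P)%E.

Inductive vpos := u | d.
Inductive hpos := l | r.
Inductive nest := NU | ND | NL | NR.

Definition bool_of_vpos (x : vpos) : bool := if x is u then true else false.
Definition vpos_of_bool (b : bool) : vpos := if b then u else d.
Lemma bool_of_vposK : cancel bool_of_vpos vpos_of_bool. Proof. by case. Qed.
HB.instance Definition _ := Finite.copy vpos (can_type bool_of_vposK).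

Definition bool_of_hpos (x : hpos) : bool := if x is l then true else false.
Definition hpos_of_bool (b : bool) : hpos := if b then l else r.
Lemma bool_of_hposK : cancel bool_of_hpos hpos_of_bool. Proof. by case. Qed.
HB.instance Definition _ := Finite.copy hpos (can_type bool_of_hposK).

Definition pair_of_nest (i : nest) : bool * bool :=
  match i with
  | NU => (true, true) | ND => (true, false)
  | NL => (false, true) | NR => (false, false)
  end.
Definition nest_of_pair (b : bool * bool) : nest :=
  match b with
  | (true, true) => NU | (true, false) => ND
  | (false, true) => NL | (false, false) => NR
  end.
Lemma pair_of_nestK : cancel pair_of_nest nest_of_pair. Proof. by case. Qed.
HB.instance Definition _ := Finite.copy nest (can_type pair_of_nestK).

Definition state : finType := (vpos * hpos)%type.

Definition event (i : nest) : {set state} :=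
  match i with
  | NU => [set (u, l); (u, r)]%SET
  | ND => [set (d, l); (d, r)]%SET
  | NL => [set (u, l); (d, l)]%SET
  | NR => [set (u, r); (d, r)]%SET
  end.

Definition uniform_prior (R : realType) (t : state) : R := 4^-1.

(* Nest marginal 1/4 times conditional; see [marg1_nu], [cond_nu], [marg2_nu]. *)
Definition nu (R : realType) (x : nest * state) : R :=
  4^-1 * (if x.2 \in event x.1 then 2^-1 else 0).

Definition indicator (R : realType) (E : {set state}) : action R state :=
  [ffun t => (t \in E)%:R].

Definition a_ (R : realType) (i : nest) : action R state :=
  indicator R (event i).
Definition a_diag (R : realType) : action R state :=
  indicator R [set (u, l); (d, r)]%SET.
Definition a_off (R : realType) : action R state :=
  indicator R [set (u, r); (d, l)]%SET.

Definition A1 (R : realType) : {fset action R state} :=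
  [fset a_ R NU; a_ R ND]%fset.
Definition A2 (R : realType) : {fset action R state} :=
  [fset a_ R NL; a_ R NR]%fset.
Definition A3 (R : realType) : {fset action R state} :=
  [fset a_diag R; a_off R]%fset.

Definition optimal (R : realType) (zeta eta : R) (A : {fset action R state})
  (P : state -> action R state -> R) : Prop :=
  optimal_rule (@uniform_prior R) (nested_entropy zeta eta (@nu R)) A P.

Lemma big_vpos (R : realType) (F : vpos -> R) : \sum_x F x = F u + F d.
Proof.
rewrite (reindex vpos_of_bool) /=; last first.
  by exists bool_of_vpos => -[].
by rewrite big_bool.
Qed.

Lemma big_hpos (R : realType) (F : hpos -> R) : \sum_x F x = F l + F r.
Proof.
rewrite (reindex hpos_of_bool) /=; last first.
  by exists bool_of_hpos => -[].
by rewrite big_bool.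
Qed.

Lemma big_state (R : realType) (F : state -> R) :
  \sum_t F t = F (u, l) + F (u, r) + (F (d, l) + F (d, r)).
Proof.
rewrite (eq_bigr (fun t => F (t.1, t.2))) => [|[] //].
rewrite -(pair_bigA _ (fun x y => F (x, y))) /=.
by rewrite big_vpos !big_hpos.
Qed.

Lemma big_nest (R : realType) (F : nest -> R) :
  \sum_i F i = F NU + F ND + (F NL + F NR).
Proof.
rewrite (reindex nest_of_pair) /=; last first.
  by exists pair_of_nest => [[[] []]|[]].
rewrite (eq_bigr (fun t => F (nest_of_pair (t.1, t.2)))) => [|[] //].
rewrite -(pair_bigA _ (fun x y => F (nest_of_pair (x, y)))) /=.
by rewrite big_bool !big_bool.
Qed.

Lemma marg1_nu (R : realType) (i : nest) : marg1 (@nu R) i = 4^-1.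
Proof.
rewrite /marg1 big_state /nu /=.
by case: i; rewrite !inE /=; field.
Qed.

Lemma cond_nu (R : realType) (i : nest) (t : state) :
  cond (@nu R) i t = if t \in event i then 2^-1 else 0.
Proof. by rewrite /cond marg1_nu /nu /= mulrAC mulfV ?mul1r // invr_neq0. Qed.

Lemma marg2_nu (R : realType) (t : state) :
  marg2 (@nu R) t = uniform_prior R t.
Proof.
rewrite /marg2 big_nest /nu /uniform_prior /=.
by case: t => -[] []; rewrite !inE /=; field.
Qed.

Lemma nu_is_dist (R : realType) : is_dist (@nu R).
Proof.
split=> [x|]; first by rewrite /nu; case: ifP => _; rewrite ?mulr0 // mulr_ge0.
rewrite (eq_bigr (fun x => @nu R (x.1, x.2))) => [|[] //].
rewrite -(pair_bigA _ (fun i t => @nu R (i, t))) /=.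
rewrite (eq_bigr (fun=> 4^-1)) => [|i _]; last exact: marg1_nu.
by rewrite big_nest; field.
Qed.

(* Main.v *)
Require Import Defs.
From HB Require Import structures.
From mathcomp Require Import all_boot all_order all_algebra.
From mathcomp Require Import finmap ring lra.
From mathcomp Require Import all_classical all_reals all_analysis.

(** Write [gamma_a (i, t)] for [nu (i, t) * exp (a t / eta) / Z].  If every nest
    has the same partition function [Z] under the payoff [a], the Gibbs
    variational principle inside each nest together with the chain rule for the
    divergence gives, for every posterior [p],
    [H p >= <p, a> - eta ln Z + c |p - marginal of gamma_a|^2] with [c > 0], and
    equality at the marginal of [gamma_a].  In the third problem each nest
    contains one state where a given action pays [1] and one where it pays [0],
    so [Z] is common to all nests and both actions: [eta ln Z] bounds every net
    payoff, the logit rule attains it, and the quadratic term forces the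
    posteriors of any optimal rule.  In the first two problems the rule
    revealing the relevant event costs at most [zeta ln 4], since all the mass
    can be put on one nest; as costs are nonnegative, an optimal rule has
    expected payoff at least [1 - zeta ln 4]. *)

Set Implicit Arguments.
Unset Strict Implicit.
Unset Printing Implicit Defensive.

Import Order.TTheory GRing.Theory Num.Theory.
Import numFieldNormedType.Exports.

Local Open Scope ring_scope.
Local Open Scope classical_set_scope.

(** * Pointwise bounds on the integrand of the divergence *)

(** With [a] and [b] the square roots of [x] and [y], the bound [ln z <= z - 1] at [z = b / a] gives
    [x ln (x / y) >= 2 a^2 - 2 a b]. This is the pointwise form of the Hellinger lower bound on the
    divergence. *)
Lemma sqr_subsqrt_le_xlnx (R : realType) (x y : R) :
  0 <= x -> 0 <= y -> (y = 0 -> x = 0) ->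
  (Num.sqrt x - Num.sqrt y) ^+ 2 <= x * ln (x / y) - x + y.
Proof.
move=> x0 y0 xy.
have [->|xn0] := eqVneq x 0.
  by rewrite sqrtr0 sub0r sqrrN sqr_sqrtr // mul0r subr0 add0r.
have yn0 : y != 0 by apply: contra_neq xn0 => /xy.
have {x0 xn0}x0 : 0 < x by rewrite lt_neqAle eq_sym xn0.
have {y0 yn0 xy}y0 : 0 < y by rewrite lt_neqAle eq_sym yn0.
have a0 : 0 < Num.sqrt x by rewrite sqrtr_gt0.
have b0 : 0 < Num.sqrt y by rewrite sqrtr_gt0.
rewrite -{2 3 4}(sqr_sqrtr (ltW x0)) -{2 3}(sqr_sqrtr (ltW y0)).
move: (Num.sqrt x) (Num.sqrt y) a0 b0 => a b a0 b0.
have ab0 : 0 < b / a by rewrite divr_gt0.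
have -> : ln (a ^+ 2 / b ^+ 2) = - (2 * ln (b / a)).
  rewrite -expr_div_n lnXn ?divr_gt0 // -[a / b]invf_div lnV ?posrE //.
  by rewrite mulNrn mulr_natl.
have : ln (1 + (b / a - 1)) <= b / a - 1 by rewrite le_ln1Dx //; lra.
rewrite addrC subrK => h.
have : a ^+ 2 * ln (b / a) <= a ^+ 2 * (b / a - 1).
  by rewrite ler_wpM2l // sqr_ge0.
have -> : a ^+ 2 * (b / a - 1) = a * b - a ^+ 2.
  by field; rewrite gt_eqF.
nra.
Qed.

Lemma sub_le_xlnx (R : realType) (x y : R) :
  0 <= x -> 0 <= y -> (y = 0 -> x = 0) -> x - y <= x * ln (x / y).
Proof.
move=> x0 y0 xy; have := sqr_subsqrt_le_xlnx x0 y0 xy.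
have := sqr_ge0 (Num.sqrt x - Num.sqrt y); lra.
Qed.

(** Factor [x - y] as [(a - b) (a + b)] in the square roots; on the unit interval [a + b <= 2],
    whence the [4]. *)
Lemma sqr_sub_le_xlnx (R : realType) (x y : R) :
  0 <= x <= 1 -> 0 <= y <= 1 -> (y = 0 -> x = 0) ->
  (x - y) ^+ 2 / 4 <= x * ln (x / y) - x + y.
Proof.
move=> /andP[x0 x1] /andP[y0 y1] xy.
apply: le_trans (sqr_subsqrt_le_xlnx x0 y0 xy).
have a1 : Num.sqrt x <= 1 by rewrite -sqrtr1 ler_wsqrtr.
have b1 : Num.sqrt y <= 1 by rewrite -sqrtr1 ler_wsqrtr.
rewrite -{1}(sqr_sqrtr x0) -{1}(sqr_sqrtr y0).
have := sqrtr_ge0 x; have := sqrtr_ge0 y.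
move: (Num.sqrt x) (Num.sqrt y) a1 b1 => a b a1 b1 b0 a0.
rewrite ler_pdivrMr // subr_sqr exprMn ler_wpM2l ?sqr_ge0 //.
have : (a + b) ^+ 2 <= 2 ^+ 2 by rewrite ler_sqr ?nnegrE; lra.
lra.
Qed.

(** Cauchy-Schwarz against the constant vector, by expanding the sum of the squares
    [(n x_i - S)^2]. *)
Lemma sqr_sum_le (R : realType) (I : finType) (x : I -> R) :
  (\sum_i x i) ^+ 2 <= #|I|%:R * \sum_i x i ^+ 2.
Proof.
have [I0|I0] := posnP #|I|.
  rewrite big_pred0 ?expr0n ?mulr_ge0 ?sumr_ge0 // => [i _|i].
    exact: sqr_ge0.
  by have := card0_eq I0 i; rewrite inE.
set n : R := #|I|%:R; set S := \sum_i x i.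
have n0 : 0 < n by rewrite ltr0n.
have : 0 <= \sum_i (n * x i - S) ^+ 2 by apply: sumr_ge0 => i _; exact: sqr_ge0.
have -> : \sum_i (n * x i - S) ^+ 2 =
    n * (n * \sum_i x i ^+ 2 - S ^+ 2).
  rewrite (eq_bigr (fun i => n ^+ 2 * x i ^+ 2 - 2 * n * S * x i + S ^+ 2));
    last by move=> i _; ring.
  rewrite big_split sumrB /= -!mulr_sumr sumr_const -/S -mulr_natl -/n; ring.
by rewrite pmulr_rge0 // subr_ge0.
Qed.

Lemma sum_pair (R : realType) (N T : finType) (F : N * T -> R) :
  \sum_x F x = \sum_i \sum_t F (i, t).
Proof. by rewrite pair_bigA; apply: eq_bigr => -[]. Qed.

(** The real value of [nested_div] under absolute continuity. The nest weight is absorbed into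
    [mu (i, t)], so nests of weight zero drop out without a side condition. *)
Definition nested_kl (R : realType) (N Theta : finType) (zeta eta : R)
    (nu mu : N * Theta -> R) : R :=
  zeta * \sum_i marg1 mu i * ln (marg1 mu i / marg1 nu i) +
  eta * \sum_i \sum_t mu (i, t) * ln (cond mu i t / cond nu i t).

Definition tilt (R : realType) (N Theta : finType) (eta Z : R)
    (nu : N * Theta -> R) (v : Theta -> R) (x : N * Theta) : R :=
  nu x * expR (v x.2 / eta) / Z.

(** * Nested divergence and nested entropy under a common partition function *)

Section NestedDivergence.
Context {R : realType} {N Theta : finType}.
Implicit Types (mu : N * Theta -> R) (v : Theta -> R).

Lemma marg1_eq0 mu i :
  (forall x, 0 <= mu x) -> marg1 mu i = 0 -> forall t, mu (i, t) = 0.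
Proof.
move=> mu0 /eqP + t; rewrite psumr_eq0 => [|s _]; last exact: mu0.
by move=> /allP /(_ t); rewrite mem_index_enum => /(_ isT) /eqP.
Qed.

Lemma sum_marg1 mu : \sum_i marg1 mu i = \sum_x mu x.
Proof. by rewrite sum_pair. Qed.

Lemma dist_le1 mu x : is_dist mu -> mu x <= 1.
Proof.
move=> [mu0 <-]; rewrite (bigD1 x) //= lerDl; apply: sumr_ge0 => y _.
exact: mu0.
Qed.

Variables (zeta eta : R) (zeta0 : 0 < zeta) (eta0 : 0 < eta).
Variables (nu : N * Theta -> R) (nu_dist : is_dist nu).
Hypothesis marg1_nu_gt0 : forall i, 0 < marg1 nu i.

Lemma nested_divE mu : is_dist mu -> (forall x, nu x = 0 -> mu x = 0) ->
  nested_div zeta eta nu mu = (nested_kl zeta eta nu mu)%:E.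
Proof.
move=> [mu0 mu1] ac; rewrite /nested_div /nested_kl {1}/KL ifT; last first.
  by apply/forallP => i; rewrite gt_eqF.
rewrite EFinD !EFinM; congr (_ + _ * _)%E.
rewrite (eq_bigr (fun i => (\sum_t mu (i, t) * ln (cond mu i t / cond nu i t))%:E)).
  rewrite sumEFin big_mkcond; congr EFin; apply: eq_bigr => i _.
  case: ifPn => // /negPn/eqP b0; rewrite big1 // => t _.
  by rewrite (marg1_eq0 mu0 b0) mul0r.
move=> i b0; rewrite /KL ifT; last first.
  apply/forallP => t; apply/implyP; rewrite /cond mulf_eq0 invr_eq0.
  by rewrite (gt_eqF (marg1_nu_gt0 i)) orbF => /eqP /ac ->; rewrite mul0r.
rewrite -EFinM mulr_sumr; congr EFin; apply: eq_bigr => t _.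
by rewrite mulrA; congr (_ * _); rewrite /cond mulrC divfK.
Qed.

(** A point charged by [mu] but not by [nu] lies in a nest of positive weight, whose conditional
    divergence is infinite; no other nest contributes minus infinity. *)
Lemma nested_div_pinfty mu : is_dist mu -> ~ (forall x, nu x = 0 -> mu x = 0) ->
  nested_div zeta eta nu mu = +oo%E.
Proof.
move=> [mu0 mu1] nac.
have [i [t [nu_it mu_it]]] : exists i t, nu (i, t) = 0 /\ mu (i, t) <> 0.
  apply: contrapT => h; apply: nac => -[i t] nu_it; apply: contrapT => mu_it.
  by apply: h; exists i, t.
rewrite /nested_div {1}/KL ifT; last by apply/forallP => j; rewrite gt_eqF.
have b0 : marg1 mu i != 0 by apply/eqP => /(marg1_eq0 mu0)/(_ t)/mu_it.
have marg1_gt0 j : marg1 mu j != 0 -> 0 < marg1 mu j.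
  by move=> bj; rewrite lt_neqAle eq_sym bj; apply: sumr_ge0.
rewrite [X in (_ + eta%:E * X)%E](_ : _ = +oo%E) -?EFinM.
  by rewrite gt0_muley ?lte_fin // addey.
apply/eqP; rewrite esum_eqy => [|j bj]; last first.
  by rewrite /KL; case: ifP => // _; rewrite gt0_muley ?lte_fin ?marg1_gt0.
apply/existsP; exists i; apply/andP; split=> //; rewrite /KL ifF.
  by rewrite gt0_muley // lte_fin marg1_gt0.
apply/negP => /forallP /(_ t); rewrite /cond nu_it mul0r eqxx /=.
by rewrite mulf_eq0 invr_eq0 (negPf b0) orbF => /eqP.
Qed.

Variables (Z : R) (Z0 : 0 < Z) (v : Theta -> R).
Hypothesis partitionE :
  forall i, \sum_t nu (i, t) * expR (v t / eta) = Z * marg1 nu i.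

Local Notation gamma := (tilt eta Z nu v).

(** Since [Z] is common to all nests, tilting moves mass only within nests; the divergence between
    nests, and with it [zeta], then disappears from the cost of [gamma]. *)
Lemma marg1_tilt i : marg1 gamma i = marg1 nu i.
Proof.
by rewrite /marg1 /tilt -mulr_suml partitionE mulrC mulKf ?gt_eqF.
Qed.

Lemma tilt_dist : is_dist gamma.
Proof.
case: nu_dist => nu0 nu1; split=> [x|].
  by rewrite /tilt divr_ge0 ?mulr_ge0 ?expR_ge0 // ltW.
rewrite sum_pair -nu1 sum_pair; apply: eq_bigr => i _; exact: marg1_tilt.
Qed.

Lemma tilt_eq0 x : gamma x = 0 -> nu x = 0.
Proof.
move/eqP; rewrite /tilt !mulf_eq0 invr_eq0 (gt_eqF Z0) (gt_eqF (expR_gt0 _)).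
by rewrite !orbF => /eqP.
Qed.

(** The summand [v t / eta - ln Z] is the log density of [gamma] with respect to [nu], here
    integrated against an arbitrary [mu]. *)
Lemma sum_log_tilt mu : is_dist mu ->
  eta * \sum_i \sum_t mu (i, t) * (v t / eta - ln Z) =
  \sum_t marg2 mu t * v t - eta * ln Z.
Proof.
move=> [_ mu1].
rewrite (eq_bigr (fun i => \sum_t mu (i, t) * (v t / eta) - ln Z * marg1 mu i)).
  rewrite sumrB -mulr_sumr sum_marg1 mu1 mulr1 mulrBr.
  congr (_ - _); rewrite exchange_big mulr_sumr; apply: eq_bigr => t _.
  rewrite /marg2 mulr_suml mulr_sumr; apply: eq_bigr => i _.
  by field; rewrite gt_eqF.
move=> i _; rewrite mulr_sumr -sumrB; apply: eq_bigr => t _; ring.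
Qed.

Lemma nested_div_tilt : nested_div zeta eta nu gamma =
  (\sum_t marg2 gamma t * v t - eta * ln Z)%:E.
Proof.
rewrite nested_divE; first last.
- by move=> x; rewrite /tilt => ->; rewrite !mul0r.
- exact: tilt_dist.
congr EFin; rewrite /nested_kl big1 ?mulr0 ?add0r => [|i _]; last first.
  by rewrite marg1_tilt divff ?gt_eqF // ln1 mulr0.
rewrite (eq_bigr (fun i => \sum_t gamma (i, t) * (v t / eta - ln Z))); last first.
  move=> i _; apply: eq_bigr => t _.
  have [g0|gn0] := eqVneq (gamma (i, t)) 0; first by rewrite g0 !mul0r.
  have nu0 : nu (i, t) != 0 by apply: contra_neq gn0; rewrite /tilt => ->; rewrite !mul0r.
  congr (_ * _); rewrite /cond marg1_tilt /tilt /=.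
  rewrite [X in ln X](_ : _ = expR (v t / eta) / Z); last first.
    by field; rewrite nu0 !gt_eqF // marg1_nu_gt0.
  by rewrite ln_div ?posrE ?expR_gt0 // expRK.
exact: sum_log_tilt tilt_dist.
Qed.

(* [zeta K + eta S >= min (zeta, eta) (K + S)], where [K] is the divergence
   between nests, [S] the one within nests relative to [gamma], and [K + S] the
   divergence of [mu] from [gamma] by the chain rule. *)
Lemma nested_kl_ge mu : is_dist mu -> (forall x, nu x = 0 -> mu x = 0) ->
  \sum_t marg2 mu t * v t - eta * ln Z +
    Num.min zeta eta / 4 * \sum_x (mu x - gamma x) ^+ 2
  <= nested_kl zeta eta nu mu.
Proof.
move=> mu_dist ac; have [mu0 mu1] := mu_dist.
have [gamma0 gamma1] := tilt_dist.
have b_ge0 i : 0 <= marg1 mu i by apply: sumr_ge0.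
have pos_at i t : mu (i, t) != 0 ->
    [/\ 0 < mu (i, t), 0 < nu (i, t) & 0 < marg1 mu i].
  move=> mn0; split; rewrite lt_neqAle eq_sym ?mn0 ?mu0 //.
    rewrite (proj1 nu_dist) andbT.
    by apply: contra_neq mn0 => /ac.
  by rewrite b_ge0 andbT; apply: contra_neq mn0 => /(marg1_eq0 mu0).
set K := \sum_i marg1 mu i * ln (marg1 mu i / marg1 nu i).
(* The reference measure is [gamma] rescaled to the nest marginal of [mu], so [S] averages the
   divergences between the conditionals of [mu] and [gamma]. *)
pose S := \sum_i \sum_t
  mu (i, t) * ln (mu (i, t) / (gamma (i, t) * (marg1 mu i / marg1 nu i))).
have KS : K + S = \sum_x mu x * ln (mu x / gamma x).
  rewrite sum_pair -big_split; apply: eq_bigr => i _ /=.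
  rewrite {1}/marg1 mulr_suml -big_split; apply: eq_bigr => t _ /=.
  have [m0|mn0] := eqVneq (mu (i, t)) 0; first by rewrite m0 !mul0r addr0.
  have [m_gt0 nu_gt0 b_gt0] := pos_at _ _ mn0.
  have n_gt0 := marg1_nu_gt0 i.
  have g_gt0 : 0 < gamma (i, t) by rewrite /tilt divr_gt0 ?mulr_gt0 ?expR_gt0.
  rewrite -mulrDr -lnM ?posrE ?divr_gt0 ?mulr_gt0 ?invr_gt0 ?expR_gt0 //.
  by congr (_ * ln _); field; rewrite ?gt_eqF ?expR_gt0.
have K0 : 0 <= K.
  apply: (@le_trans _ _ (\sum_i (marg1 mu i - marg1 nu i))).
    by rewrite sumrB !sum_marg1 mu1 (proj2 nu_dist) subrr.
  apply: ler_sum => i _; apply: sub_le_xlnx => //; first exact: ltW.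
  by move/eqP; rewrite gt_eqF.
have S0 : 0 <= S.
  apply: sumr_ge0 => i _.
  apply: (@le_trans _ _ (\sum_t
      (mu (i, t) - gamma (i, t) * (marg1 mu i / marg1 nu i)))).
    rewrite sumrB -mulr_suml -/(marg1 mu i) -/(marg1 gamma i) marg1_tilt.
    by rewrite mulrC divfK ?gt_eqF // subrr.
  apply: ler_sum => t _; apply: sub_le_xlnx => //.
    by rewrite mulr_ge0 // divr_ge0 // ltW.
  move/eqP; rewrite mulf_eq0 => /orP[/eqP/tilt_eq0/ac //|].
  rewrite mulf_eq0 invr_eq0 (gt_eqF (marg1_nu_gt0 i)) orbF => /eqP b0.
  exact: marg1_eq0.
(* The linear terms of the pointwise bound cancel in the sum because [mu] and [gamma] both have mass
   one. *)
have KS_ge : 4^-1 * \sum_x (mu x - gamma x) ^+ 2 <= K + S.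
  apply: (@le_trans _ _ (\sum_x (mu x * ln (mu x / gamma x) - mu x + gamma x))).
    rewrite mulr_sumr; apply: ler_sum => x _; rewrite mulrC.
    apply: sqr_sub_le_xlnx.
    - by rewrite mu0 dist_le1.
    - by rewrite gamma0 (dist_le1 _ tilt_dist).
    - by move/tilt_eq0/ac.
  by rewrite big_split sumrB /= mu1 gamma1 subrK KS.
(* Passing from [nu] to [gamma] inside the nests adds the log density, which [sum_log_tilt]
   evaluates. *)
have -> : nested_kl zeta eta nu mu =
    zeta * K + eta * S + (\sum_t marg2 mu t * v t - eta * ln Z).
  rewrite /nested_kl -/K -addrA; congr (_ + _).
  rewrite -sum_log_tilt // -mulrDr -big_split; congr (_ * _).
  apply: eq_bigr => i _; rewrite -big_split; apply: eq_bigr => t _ /=.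
  have [m0|mn0] := eqVneq (mu (i, t)) 0; first by rewrite m0 !mul0r addr0.
  have [m_gt0 nu_gt0 b_gt0] := pos_at _ _ mn0.
  have n_gt0 := marg1_nu_gt0 i.
  rewrite -mulrDr; congr (_ * _).
  rewrite -[v t / eta]expRK -ln_div ?posrE ?expR_gt0 // -lnM ?posrE.
  - by congr ln; rewrite /cond /tilt /=; field; rewrite ?gt_eqF ?expR_gt0.
  - by rewrite !(divr_gt0, mulr_gt0) ?expR_gt0.
  - by rewrite divr_gt0 ?expR_gt0.
rewrite addrC lerD2r.
have m_zeta : Num.min zeta eta <= zeta by rewrite ge_min lexx.
have m_eta : Num.min zeta eta <= eta by rewrite ge_min lexx orbT.
have m0 : 0 < Num.min zeta eta by rewrite lt_min zeta0.
apply: (@le_trans _ _ (Num.min zeta eta * (K + S))).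
  by rewrite -mulrA ler_pM2l.
by rewrite mulrDr lerD // ler_wpM2r.
Qed.

(** The error of the marginal at [t] is the sum over nests of [mu - gamma] at [t]; Cauchy-Schwarz
    costs the factor [#|N|], and the squares at the other states are discarded. *)
Lemma nested_entropy_ge p t :
  ((\sum_s p s * v s - eta * ln Z +
    Num.min zeta eta / (4 * #|N|%:R) * (p t - marg2 gamma t) ^+ 2)%R%:E
  <= nested_entropy zeta eta nu p)%E.
Proof.
apply: le_ereal_inf_tmp => _ [mu [mu_dist mu_p] <-].
have [ac|nac] := pselect (forall x, nu x = 0 -> mu x = 0); last first.
  by rewrite nested_div_pinfty // leey.
rewrite nested_divE // lee_fin; apply: le_trans (nested_kl_ge mu_dist ac).
under eq_bigr do rewrite -mu_p.
rewrite lerD2l -mu_p /marg2 -sumrB invfM [X in X * _]mulrA -[leLHS]mulrA.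
rewrite ler_wpM2l //.
  by rewrite divr_ge0 // le_min !ltW.
have [N0|N0] := posnP #|N|.
  by rewrite N0 invr0 mul0r sumr_ge0 // => x _; exact: sqr_ge0.
rewrite mulrC ler_pdivrMr ?ltr0n // mulrC; apply: le_trans (sqr_sum_le _) _.
rewrite ler_wpM2l // sum_pair exchange_big (bigD1 t) //= lerDl.
by apply: sumr_ge0 => s _; apply: sumr_ge0 => i _; exact: sqr_ge0.
Qed.

Lemma nested_entropy_tilt : (nested_entropy zeta eta nu (marg2 gamma) <=
  (\sum_t marg2 gamma t * v t - eta * ln Z)%:E)%E.
Proof.
apply: ge_ereal_inf; exists (nested_div zeta eta nu gamma).
  by exists gamma => //; split=> //; exact: tilt_dist.
by rewrite nested_div_tilt.
Qed.

(** The competitor puts all mass on nest [i] with conditional [nu_i]: nothing is paid within the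
    nest, and a point mass on [i] has divergence [- ln (marg1 nu i)] from the nest marginal. *)
Lemma nested_entropy_cond i :
  (nested_entropy zeta eta nu (cond nu i) <= (zeta * - ln (marg1 nu i))%:E)%E.
Proof.
have [nu0 nu1] := nu_dist.
have n_gt0 := marg1_nu_gt0 i.
pose mu (x : N * Theta) := (x.1 == i)%:R * cond nu i x.2.
have cond1 : \sum_t cond nu i t = 1.
  by rewrite /cond -mulr_suml divff ?gt_eqF.
have marg1_mu j : marg1 mu j = (j == i)%:R.
  by rewrite /marg1 /mu /= -mulr_sumr cond1 mulr1.
have mu_dist : is_dist mu.
  split=> [x|]; first by rewrite mulr_ge0 // divr_ge0 // ltW.
  rewrite sum_pair; under eq_bigr do rewrite -/(marg1 mu _) marg1_mu.
  by rewrite (bigD1 i) //= eqxx big1 ?addr0 // => j /negPf ->.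
apply: ge_ereal_inf; exists (nested_div zeta eta nu mu).
  exists mu => //; split=> // t; rewrite /marg2 (bigD1 i) //= big1 ?addr0.
    by rewrite /mu eqxx mul1r.
  by move=> j ji; rewrite /mu (negPf ji) mul0r.
rewrite nested_divE //; last first.
  move=> [j t] nu_jt; rewrite /mu /=; case: eqP => [<-|]; rewrite ?mul0r //.
  by rewrite /cond nu_jt mul0r mulr0.
rewrite lee_fin /nested_kl [X in eta * X]big1 ?mulr0 ?addr0; last first.
  move=> j _; rewrite big1 // => t _; rewrite {1}/mu /=.
  case: eqP => [->|]; rewrite ?mul0r // mul1r.
  rewrite {2}/cond marg1_mu eqxx divr1 /mu /= eqxx mul1r.
  have [->|c0] := eqVneq (cond nu i t) 0; first by rewrite mul0r.
  by rewrite divff // ln1 mulr0.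
rewrite (bigD1 i) //= big1 ?addr0 => [|j ji]; last first.
  by rewrite marg1_mu (negPf ji) mul0r.
by rewrite marg1_mu eqxx mul1r mul1r lnV.
Qed.

End NestedDivergence.

(** The payoff [v = 0] with [Z = 1] in [nested_kl_ge] leaves only the nonnegative square term. *)
Lemma nested_entropy_ge0 (R : realType) (N Theta : finType) (zeta eta : R)
    (nu : N * Theta -> R) (p : Theta -> R) :
  0 < zeta -> 0 < eta -> is_dist nu -> (forall i, 0 < marg1 nu i) ->
  (0 <= nested_entropy zeta eta nu p)%E.
Proof.
move=> zeta0 eta0 nu_dist n0; apply: le_ereal_inf_tmp => _ [mu [mu_dist _] <-].
have [ac|nac] := pselect (forall x, nu x = 0 -> mu x = 0); last first.
  by rewrite nested_div_pinfty // leey.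
rewrite nested_divE // lee_fin.
apply: le_trans (@nested_kl_ge _ _ _ _ _ zeta0 eta0 _ nu_dist n0
  1 ltr01 (fun=> 0) _ _ mu_dist ac) => [|i].
  rewrite big1 => [|t _]; last by rewrite mulr0.
  rewrite ln1 mulr0 subrr add0r mulr_ge0 //; first by rewrite divr_ge0 // le_min !ltW.
  by apply: sumr_ge0 => x _; exact: sqr_ge0.
by rewrite mul1r; apply: eq_bigr => t _; rewrite mul0r expR0 mulr1.
Qed.

(** * Stochastic choice with a posterior-separable cost *)

Section StochasticChoice.
Context {R : realType} {Theta : finType}.
Variables (prior : Theta -> R) (prior_dist : is_dist prior).
Variables (A : {fset action R Theta}).
Implicit Types (P Q : Theta -> action R Theta -> R) (H : (Theta -> R) -> \bar R).

Lemma action_prob_ge0 P a : is_rule A P -> a \in A -> 0 <= action_prob prior P a.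
Proof.
move=> ruleP aA; apply: sumr_ge0 => t _.
by rewrite mulr_ge0 ?(proj1 prior_dist) ?(proj1 (ruleP t)).
Qed.

Lemma action_prob_eq0 P a t : is_rule A P -> a \in A ->
  action_prob prior P a = 0 -> prior t * P t a = 0.
Proof.
move=> ruleP aA /eqP; rewrite psumr_eq0 => [|s _]; last first.
  by rewrite mulr_ge0 ?(proj1 prior_dist) ?(proj1 (ruleP s)).
by move=> /allP /(_ t); rewrite mem_index_enum => /(_ isT) /eqP.
Qed.

Lemma sum_action_prob P : is_rule A P -> \sum_(a <- A) action_prob prior P a = 1.
Proof.
move=> ruleP; rewrite exchange_big -(proj2 prior_dist).
by apply: eq_bigr => t _; rewrite -mulr_sumr (proj2 (ruleP t)) mulr1.
Qed.

(** For an action of probability zero the posterior divides by zero, but both sides vanish there by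
    [action_prob_eq0]. *)
Lemma payoffE P : is_rule A P ->
  \sum_t prior t * (\sum_(a <- A) P t a * a t) =
  \sum_(a <- A) action_prob prior P a * \sum_t posterior prior P a t * a t.
Proof.
move=> ruleP; under eq_bigr do rewrite mulr_sumr.
rewrite exchange_big; apply: eq_big_seq => a aA; rewrite mulr_sumr.
apply: eq_bigr => t _; rewrite /posterior.
have [p0|pn0] := eqVneq (action_prob prior P a) 0.
  by rewrite mulrA p0 mul0r (action_prob_eq0 t ruleP aA p0) mul0r.
by field.
Qed.

Lemma posterior_separable_cost_ge H P (L : action R Theta -> R) :
  is_rule A P ->
  (forall a, a \in A -> action_prob prior P a != 0 ->
     ((L a)%:E <= H (posterior prior P a))%E) ->
  ((\sum_(a <- A) action_prob prior P a * L a)%:E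
     <= posterior_separable_cost prior H A P)%E.
Proof.
move=> ruleP LH; rewrite /posterior_separable_cost -sumEFin [leRHS]big_mkcond /=.
rewrite big_seq [leRHS]big_seq; apply: lee_sum => a aA.
case: ifPn => [pn0|/negPn/eqP ->]; last by rewrite mul0r.
by rewrite EFinM lee_wpmul2l ?lee_fin ?action_prob_ge0 ?LH.
Qed.

Lemma posterior_separable_cost_le H P (L : action R Theta -> R) :
  is_rule A P ->
  (forall a, a \in A -> action_prob prior P a != 0 ->
     (H (posterior prior P a) <= (L a)%:E)%E) ->
  (posterior_separable_cost prior H A P
     <= (\sum_(a <- A) action_prob prior P a * L a)%:E)%E.
Proof.
move=> ruleP LH; rewrite /posterior_separable_cost -sumEFin [leLHS]big_mkcond /=.
rewrite big_seq [leRHS]big_seq; apply: lee_sum => a aA.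
case: ifPn => [pn0|/negPn/eqP ->]; last by rewrite mul0r.
by rewrite EFinM lee_wpmul2l ?lee_fin ?action_prob_ge0 ?LH.
Qed.

(** Turns optimality into a real inequality: one-sided bounds on the entropies suffice, below for
    [P] and above for [Q], so no cost has to be computed exactly. *)
Lemma optimal_rule_payoff_ge H P Q (L1 L2 : action R Theta -> R) :
  optimal_rule prior H A P -> is_rule A Q ->
  (forall a, a \in A -> action_prob prior P a != 0 ->
     ((L1 a)%:E <= H (posterior prior P a))%E) ->
  (forall a, a \in A -> action_prob prior Q a != 0 ->
     (H (posterior prior Q a) <= (L2 a)%:E)%E) ->
  \sum_t prior t * (\sum_(a <- A) Q t a * a t)
    - \sum_(a <- A) action_prob prior Q a * L2 a <=
  \sum_t prior t * (\sum_(a <- A) P t a * a t)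
    - \sum_(a <- A) action_prob prior P a * L1 a.
Proof.
move=> [ruleP optP] ruleQ LP LQ; rewrite -lee_fin !EFinB.
apply: le_trans (le_trans (optP Q ruleQ) _).
  by rewrite /net_payoff leeB // posterior_separable_cost_le.
by rewrite /net_payoff leeB // posterior_separable_cost_ge.
Qed.

(** * Posteriors forced on optimal rules by a common partition function *)

Section TiltedPosterior.
Variables (N : finType) (zeta eta : R) (zeta0 : 0 < zeta) (eta0 : 0 < eta).
Variables (nu : N * Theta -> R) (nu_dist : is_dist nu).
Hypothesis marg1_nu_gt0 : forall i, 0 < marg1 nu i.
Variables (Z : R) (Z0 : 0 < Z).
Hypothesis partitionE : forall a, a \in A ->
  forall i, \sum_t nu (i, t) * expR (a t / eta) = Z * marg1 nu i.

(* [eta * ln Z] bounds every net payoff; [Q] attains it, so the square error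
   term in [nested_entropy_ge] has to vanish at the posteriors of [P]. *)
Lemma optimal_rule_posterior P Q :
  optimal_rule prior (nested_entropy zeta eta nu) A P -> is_rule A Q ->
  (forall a, a \in A -> action_prob prior Q a != 0 ->
     posterior prior Q a = marg2 (tilt eta Z nu a)) ->
  forall a t, a \in A -> action_prob prior P a != 0 ->
    posterior prior P a t = marg2 (tilt eta Z nu a) t.
Proof.
move=> optP ruleQ postQ a t aA pn0.
have ruleP := proj1 optP.
have N0 : (0 < #|N|)%N.
  rewrite lt0n; apply/eqP => N0; have := proj2 nu_dist.
  rewrite sum_pair big_pred0 => [/esym/eqP|i]; first by rewrite oner_eq0.
  by have := card0_eq N0 i; rewrite inE.
pose c := Num.min zeta eta / (4 * #|N|%:R).
have c0 : 0 < c by rewrite divr_gt0 ?lt_min ?zeta0 ?mulr_gt0 ?ltr0n.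
pose e b := c * (posterior prior P b t - marg2 (tilt eta Z nu b) t) ^+ 2.
have := optimal_rule_payoff_ge optP ruleQ
  (fun b bA _ => nested_entropy_ge zeta0 eta0 nu_dist marg1_nu_gt0 Z0
                   (partitionE bA) _ t)
  (L2 := fun b => \sum_t posterior prior Q b t * b t - eta * ln Z).
(* The posterior payoffs cancel against the linear part of the entropy bound. This is applied with
   [f = e] for [P] and [f = 0] for [Q]. *)
have pay P' (f : action R Theta -> R) : is_rule A P' ->
  \sum_t prior t * (\sum_(a <- A) P' t a * a t) -
  \sum_(a <- A) action_prob prior P' a *
    (\sum_t posterior prior P' a t * a t - eta * ln Z + f a) =
  eta * ln Z - \sum_(a <- A) action_prob prior P' a * f a.
  move=> ruleP'; rewrite payoffE // -sumrB -[X in X - _]mul1r.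
  rewrite -(sum_action_prob ruleP') mulr_suml -sumrB.
  by apply: eq_bigr => b _; ring.
rewrite (pay P e) //.
have := pay Q (fun=> 0) ruleQ.
under [X in _ - X]eq_bigr do rewrite addr0.
rewrite [X in _ = _ - X -> _]big1 ?subr0 => [->|b _]; last by rewrite mulr0.
move=> /(_ _) h.
have {h} : \sum_(b <- A) action_prob prior P b * e b <= 0.
  have : eta * ln Z <= eta * ln Z - \sum_(b <- A) action_prob prior P b * e b.
    apply: h => b bA qn0; rewrite /= postQ //.
    exact: (nested_entropy_tilt zeta eta0 nu_dist marg1_nu_gt0 Z0 (partitionE bA)).
  by rewrite lerBrDr gerDl.
have e0 b : 0 <= e b by rewrite mulr_ge0 ?sqr_ge0 // ltW.
rewrite (big_fsetD1 a) //= => h.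
have : action_prob prior P a * e a <= 0.
  apply: le_trans h; rewrite lerDl big_seq; apply: sumr_ge0 => b.
  by rewrite !inE => /andP[_ bA]; rewrite mulr_ge0 ?action_prob_ge0.
rewrite pmulr_rle0 ?lt_neqAle 1?eq_sym ?pn0 ?action_prob_ge0 //.
rewrite pmulr_rle0 // => h2.
by apply/eqP; rewrite -subr_eq0 -sqrf_eq0 eq_le h2 sqr_ge0.
Qed.

End TiltedPosterior.

End StochasticChoice.

(** * The three decision problems on the four states *)

Lemma sum_fset2 (R : nmodType) (K : choiceType) (x y : K) (F : K -> R) :
  x != y -> \sum_(a <- [fset x; y]%fset) F a = F x + F y.
Proof. by move=> xy; rewrite big_fsetU1 ?inE // big_seq_fset1. Qed.

Section NestedProblems.
Context {R : realType}.
Implicit Types (zeta eta : R) (E : {set state}).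

Lemma uniform_prior_dist : is_dist (@uniform_prior R).
Proof.
by split=> [t|]; rewrite ?big_state /uniform_prior; [rewrite invr_ge0|field].
Qed.

Lemma marg1_nu_gt0 i : 0 < marg1 (@nu R) i.
Proof. by rewrite marg1_nu invr_gt0. Qed.

Lemma indicator_neq_setC E : indicator R E != indicator R (~: E)%SET.
Proof.
apply/eqP => /ffunP /(_ (u, l)); rewrite !ffunE !inE => /eqP.
by case: (_ \in E); rewrite ?oner_eq0 // eq_sym oner_eq0.
Qed.

Lemma indicator_setC E t : indicator R (~: E)%SET t = 1 - indicator R E t.
Proof. by rewrite !ffunE inE; case: (_ \in E); rewrite ?subrr ?subr0. Qed.

Lemma event_ND : event ND = (~: event NU)%SET.
Proof. by apply/setP => -[[] []]; rewrite !inE. Qed.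

Lemma event_NR : event NR = (~: event NL)%SET.
Proof. by apply/setP => -[[] []]; rewrite !inE. Qed.

Lemma a_offE : a_off R = indicator R (~: [set (u, l); (d, r)])%SET.
Proof. by apply/ffunP => -[[] []]; rewrite !ffunE !inE. Qed.

(** Links the revealing rule to [nested_entropy_cond]: learning an event leaves exactly the
    conditional of its nest. *)
Lemma posterior_revealing i :
  posterior (@uniform_prior R) (fun t a => a t) (a_ R i) = cond (@nu R) i.
Proof.
apply/funext => t; rewrite cond_nu /posterior /action_prob big_state.
rewrite /uniform_prior !ffunE.
by case: i; case: t => -[] []; rewrite !inE /=; field.
Qed.

(** In each state exactly one of the two actions pays, so the payoff lost is the probability of the
    wrong one. *)
Lemma indicator_payoffE E P t :
  is_rule [fset indicator R E; indicator R (~: E)%SET]%fset P ->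
  \sum_(a <- [fset indicator R E; indicator R (~: E)%SET]%fset) P t a * a t =
  1 - `|P t (indicator R E) - indicator R E t|.
Proof.
move=> /(_ t) [P0]; rewrite !sum_fset2 ?indicator_neq_setC // indicator_setC.
have := P0 (indicator R E); rewrite !inE eqxx => /(_ isT) x0.
have := P0 (indicator R (~: E)%SET); rewrite !inE eqxx orbT => /(_ isT) y0 P1.
rewrite ffunE; case: (_ \in E) => /=.
  by rewrite ler0_norm; lra.
by rewrite subr0 ger0_norm; lra.
Qed.

(** Comparison with the revealing rule, bounding the cost of [P] below by zero, makes the average
    error over states at most [zeta * ln 4]. Each state has weight 1/4, hence the factor [4]. *)
Lemma optimal_near_indicator zeta eta i j P t a :
  0 < zeta -> 0 < eta -> event j = (~: event i)%SET ->
  optimal zeta eta [fset a_ R i; a_ R j]%fset P ->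
  a \in [fset a_ R i; a_ R j]%fset ->
  `|P t a - a t| <= 4 * (zeta * ln 4).
Proof.
move=> zeta0 eta0 ij opt aA; have [ruleP _] := opt.
have ajE : a_ R j = indicator R (~: event i)%SET by rewrite /a_ ij.
have nij : a_ R i != a_ R j by rewrite ajE indicator_neq_setC.
have ruleQ : is_rule [fset a_ R i; a_ R j]%fset (fun s (b : action R state) => b s).
  move=> s; split=> [b|]; first by rewrite !inE => /orP[] /eqP ->; rewrite ffunE.
  by rewrite sum_fset2 // ajE indicator_setC addrC subrK.
have := optimal_rule_payoff_ge uniform_prior_dist opt ruleQ
  (fun b _ _ => nested_entropy_ge0 _ zeta0 eta0 (nu_is_dist R) marg1_nu_gt0)
  (L2 := fun=> zeta * ln 4).
rewrite -mulr_suml sum_action_prob ?mul1r //; last exact: uniform_prior_dist.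
rewrite [X in _ <= _ - X]big1 ?subr0 => [|b _]; last by rewrite mulr0.
have Q_le b : b \in [fset a_ R i; a_ R j]%fset ->
    action_prob (@uniform_prior R) (fun s (b : action R state) => b s) b != 0 ->
    (nested_entropy zeta eta (@nu R) (posterior (@uniform_prior R)
      (fun s (b : action R state) => b s) b) <= (zeta * ln 4)%:E)%E.
  have H_le k : (nested_entropy zeta eta (@nu R) (cond (@nu R) k)
      <= (zeta * ln 4)%:E)%E.
    have -> : ln (4 : R) = - ln (marg1 (@nu R) k) by rewrite marg1_nu lnV ?posrE // opprK.
    by apply: nested_entropy_cond => //; [exact: nu_is_dist | exact: marg1_nu_gt0].
  by rewrite !inE => /orP[] /eqP -> _; rewrite posterior_revealing.
move=> /(_ Q_le).
pose e s := `|P s (a_ R i) - a_ R i s|.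
have payE Q s : is_rule [fset a_ R i; a_ R j]%fset Q ->
    \sum_(b <- [fset a_ R i; a_ R j]%fset) Q s b * b s =
    1 - `|Q s (a_ R i) - a_ R i s|.
  by rewrite ajE; exact: indicator_payoffE.
under eq_bigr do rewrite (payE _ _ ruleQ) subrr normr0 subr0.
under [leRHS]eq_bigr do rewrite payE // -/(e _).
have -> : `|P t a - a t| = e t.
  move: aA; rewrite !inE => /orP[] /eqP -> //.
  have [_] := ruleP t; rewrite sum_fset2 // /e ajE indicator_setC -ajE -/(a_ R i).
  move=> PE; have -> : P t (a_ R j) - (1 - a_ R i t) = - (P t (a_ R i) - a_ R i t).
    by lra.
  by rewrite normrN.
have e_le : e t <= \sum_s e s.
  by rewrite (bigD1 t) //= lerDl; apply: sumr_ge0 => s _; exact: normr_ge0.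
rewrite -!mulr_sumr sumrB => h; apply: le_trans e_le _.
by move: h; rewrite !big_state /uniform_prior; lra.
Qed.

Lemma squeeze_at_right0 (c : R) (f : R -> R) (x : R) :
  (forall z, 0 < z -> `|f z - x| <= c * z) -> f z @[z --> 0^'+] --> x.
Proof.
move=> fx; apply: (squeeze_cvgr (f := fun z => x - c * z)
  (h := fun z => x + c * z)).
- near=> z; rewrite -ler_distl fx //.
- rewrite -[X in _ --> X](_ : x - c * 0 = x); last by rewrite mulr0 subr0.
  apply: cvg_at_right_filter; apply: cvgB; first exact: cvg_cst.
  by apply: cvgM; [exact: cvg_cst|exact: cvg_id].
- rewrite -[X in _ --> X](_ : x + c * 0 = x); last by rewrite mulr0 addr0.
  apply: cvg_at_right_filter; apply: cvgD; first exact: cvg_cst.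
  by apply: cvgM; [exact: cvg_cst|exact: cvg_id].
Unshelve. all: by end_near. Qed.

(** The tilting factor depends on the state alone, so it leaves the sum over nests and only the
    uniform marginal of [nu] remains. *)
Lemma marg2_tilt eta Z (v : state -> R) t :
  marg2 (tilt eta Z (@nu R) v) t = 4^-1 * expR (v t / eta) / Z.
Proof. by rewrite /marg2 /tilt /= -!mulr_suml -/(marg2 (@nu R) t) marg2_nu. Qed.

(** The forced posteriors determine [P] up to the total probability of each action; normalisation
    then fixes these at one half. *)
Lemma optimal_diag_off zeta eta P t a :
  0 < zeta -> 0 < eta -> optimal zeta eta (A3 R) P -> a \in A3 R ->
  P t a = expR (a t / eta) / (expR (1 / eta) + 1).
Proof.
move=> zeta0 eta0 opt aA; have [ruleP _] := opt.
have nij : a_diag R != a_off R by rewrite a_offE indicator_neq_setC.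
set E := expR (1 / eta).
have E1 : 1 < E by rewrite expR_gt1 divr_gt0.
have En0 : E + 1 != 0 by lra.
(* Each nest holds one state paying 1 and one paying 0, each of conditional probability one half. *)
pose Z := (E + 1) / 2.
have Z0 : 0 < Z by rewrite /Z; lra.
pose Q s (b : action R state) := expR (b s / eta) / (E + 1).
have expE (b : bool) : expR (b%:R / eta) = if b then E else 1.
  by case: b => //; rewrite mul0r expR0.
have diagE s : expR (a_diag R s / eta) =
    if s \in [set (u, l); (d, r)]%SET then E else 1 by rewrite ffunE expE.
have offE s : expR (a_off R s / eta) =
    if s \in [set (u, r); (d, l)]%SET then E else 1 by rewrite ffunE expE.
have ruleQ : is_rule (A3 R) Q.
  move=> s; split=> [b _|]; first by rewrite divr_ge0 ?expR_ge0 //; lra.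
  rewrite sum_fset2 // /Q -mulrDl diagE offE.
  by case: s => -[] []; rewrite !inE /=; field.
have partE b : b \in A3 R -> forall i,
    \sum_s @nu R (i, s) * expR (b s / eta) = Z * marg1 (@nu R) i.
  rewrite !inE => /orP[] /eqP -> i; rewrite big_state marg1_nu ?diagE ?offE.
    by rewrite /nu /Z; case: i; rewrite !inE /=; field.
  by rewrite /nu /Z; case: i; rewrite !inE /=; field.
have apQ b : b \in A3 R -> action_prob (@uniform_prior R) Q b = 2^-1.
  rewrite !inE => /orP[] /eqP ->; rewrite /action_prob big_state /Q.
    by rewrite !diagE !inE /uniform_prior /=; field.
  by rewrite !offE !inE /uniform_prior /=; field.
have postQ b : b \in A3 R -> action_prob (@uniform_prior R) Q b != 0 ->
    posterior (@uniform_prior R) Q b = marg2 (tilt eta Z (@nu R) b).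
  move=> bA _; apply/funext => s; rewrite marg2_tilt /posterior apQ //.
  by rewrite /Q /Z /uniform_prior; field.
pose p b := action_prob (@uniform_prior R) P b.
(* Bayes' rule gives [4 * p b] times the posterior, and [Z] halves the denominator, which leaves the
   factor [2]. If [p b = 0], both sides are zero. *)
have PE b s : b \in A3 R -> P s b = 2 * p b * (expR (b s / eta) / (E + 1)).
  move=> bA; have [p0|pn0] := eqVneq (p b) 0.
    have := action_prob_eq0 uniform_prior_dist s ruleP bA p0.
    by rewrite /uniform_prior p0; lra.
  have := optimal_rule_posterior uniform_prior_dist zeta0 eta0 (nu_is_dist R)
    marg1_nu_gt0 Z0 partE opt ruleQ postQ s bA pn0.
  rewrite marg2_tilt /posterior -/(p b) => /(congr1 ( *%R (4 * p b))).
  have -> : 4 * p b * (uniform_prior R s * P s b / p b) = P s b.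
    by rewrite /uniform_prior; field.
  by move=> ->; rewrite /Z; field.
have dA : a_diag R \in A3 R by rewrite !inE eqxx.
have oA : a_off R \in A3 R by rewrite !inE eqxx orbT.
have := sum_action_prob uniform_prior_dist ruleP.
rewrite sum_fset2 // -!/(p _) => pdo.
(* One state is enough: normalisation at [(u, l)] and the total probability are two linear equations
   in the two action probabilities, independent because [E > 1]. *)
have [_] := ruleP (u, l); rewrite sum_fset2 // !PE // diagE offE !inE /=.
have -> : 2 * p (a_diag R) * (E / (E + 1)) + 2 * p (a_off R) * (1 / (E + 1)) =
    (2 * p (a_diag R) * E + 2 * p (a_off R)) / (E + 1) by field.
move=> /(congr1 ( *%R^~ (E + 1))); rewrite divfK // mul1r => h.
have : (2 * p (a_diag R) - 1) * (E - 1) = 0.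
  have := congr1 ( *%R^~ 2) pdo; rewrite mulrDl mul1r; lra.
move=> /eqP; rewrite mulf_eq0 [E - 1 == 0]subr_eq0 (gt_eqF E1) orbF => /eqP pd.
have {pd}p_half : p a = 2^-1.
  by move: aA; rewrite !inE => /orP[] /eqP ->; lra.
by rewrite p_half mulfV ?mul1r.
Qed.

End NestedProblems.

Theorem proposition17 (R : realType) (eta : R) (eta_gt0 : 0 < eta)
  (P1 P2 P3 : R -> state -> action R state -> R)
  (opt1 : forall zeta : R, 0 < zeta -> optimal zeta eta (A1 R) (P1 zeta))
  (opt2 : forall zeta : R, 0 < zeta -> optimal zeta eta (A2 R) (P2 zeta))
  (opt3 : forall zeta : R, 0 < zeta -> optimal zeta eta (A3 R) (P3 zeta)) :
  (forall (a1 a2 : action R state) (t : state),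
     a1 \in A1 R -> a2 \in A2 R ->
     (P1 zeta t a1 @[zeta --> 0^'+] --> a1 t) /\
     (P2 zeta t a2 @[zeta --> 0^'+] --> a2 t)) /\
  (forall (zeta : R) (t : state) (a3 : action R state),
     0 < zeta -> a3 \in A3 R ->
     P3 zeta t a3 =
       if a3 t == 1 then expR (1 / eta) / (expR (1 / eta) + 1)
       else 1 / (expR (1 / eta) + 1)).
Proof.
split=> [a1 a2 t a1A a2A|zeta t a3 zeta0 a3A].
  split; apply: (@squeeze_at_right0 _ (4 * ln 4)) => zeta zeta0.
    rewrite -mulrA [ln 4 * _]mulrC.
    exact: optimal_near_indicator event_ND (opt1 _ zeta0) a1A.
  rewrite -mulrA [ln 4 * _]mulrC.
  exact: optimal_near_indicator event_NR (opt2 _ zeta0) a2A.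
rewrite (optimal_diag_off _ zeta0 eta_gt0 (opt3 _ zeta0) a3A).
(* Payoffs are 0 or 1, and [exp 0 = 1] merges the two branches into one logit formula. *)
suff [->|->] : a3 t = 1 \/ a3 t = 0.
- by rewrite eqxx.
- by rewrite eq_sym oner_eq0 mul0r expR0.
- move: a3A; rewrite !inE => /orP[] /eqP ->; rewrite ffunE.
  by case: (_ \in _); [left|right].
  by case: (_ \in _); [left|right].
Qed.
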